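(* Let $G$ be a connected graph of order $n\ge 2$ and let $H$ be a non-trivial graph. The following are equivalent: (i) for every local adjacency basis $S$ for $H$ there exists some $v\in V(H)\setminus S$ with $S\subseteq N_H(v)$; (ii) $\operatorname{dim}_{A,l}(G\odot H)=n\cdot \operatorname{dim}_{A,l}(H)+\gamma(G)$; (iii) $\operatorname{dim}_l(G\odot H)=\operatorname{dim}_{A,l}(G\odot H)-\gamma(G)$.
   Context: All graphs are finite, simple, undirected; non-trivial means order at least 2. For a connected graph with shortest-path distance $d$, a local metric generator is a vertex set $S$ such that every two adjacent vertices $x,y$ satisfy $d(s,x)\ne d(s,y)$ for some $s\in S$; $\operatorname{dim}_l$ is the minimum size of a local metric generator. A vertex set $S$ is a local adjacency generator of a graph if for every two adjacent vertices $x,y$ not in $S$ there exists $s\in S$ with $|N(s)\cap\{x,y\}|=1$ ($N$ the open neighbourhood); a local adjacency basis is one of minimum cardinality, and this cardinality is $\operatorname{dim}_{A,l}$. $\gamma(G)$ is the domination number of $G$. The corona product $G\odot H$ ($G$ of order $n$ with vertices $v_1,\dots,v_n$) consists of $G$ and $n$ disjoint copies $H_1,\dots,H_n$ of $H$, with $v_i$ joined to every vertex of $H_i$.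
   Formalization: H is additionally assumed to have at least one edge; for edgeless H the equivalence always fails, since (i) holds vacuously while (ii) and (iii) together would give dim_l(G⊙H)=0 (e.g. G=K2, H=2K1: (i), (ii) hold but dim_l=1≠1−1). *)

(* Defs.v *)
(* MathComp *)
From mathcomp Require Import all_boot.
Set Implicit Arguments.
Unset Strict Implicit.
Unset Printing Implicit Defensive.

Record sgraph := SGraph {
  vertex :> finType;
  adj : rel vertex;
  adj_sym : symmetric adj;
  adj_irr : irreflexive adj }.

Definition connected_graph (G : sgraph) : Prop :=
  forall x y : G, connect (@adj G) x y.

Definition nbh (G : sgraph) (x : G) : {set G} := [set y | adj x y].

Definition has_walk (G : sgraph) (k : nat) (x y : G) : bool :=
  [exists p : k.-tuple G, path (@adj G) x p && (last x p == y)].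

(* A shortest path has fewer than #|G| edges, so the minimum is taken over
   lengths k < #|G|; the default value #|G| is reached only when x and y lie in
   different components. *)
Definition dist (G : sgraph) (x y : G) : nat :=
  \big[minn/#|G|]_(k < #|G| | has_walk k x y) k.

Definition local_metric_generator (G : sgraph) (S : {set G}) : bool :=
  [forall x, forall y, adj x y ==> [exists s in S, dist s x != dist s y]].

Definition local_adj_generator (G : sgraph) (S : {set G}) : bool :=
  [forall x, forall y, [&& adj x y, x \notin S & y \notin S] ==>
     [exists s in S, #|nbh s :&: [set x; y]| == 1]].

Definition dominating (G : sgraph) (S : {set G}) : bool :=
  [forall x, (x \in S) || [exists s in S, adj s x]].

(* The default value #|T| is the size of [set: T], which satisfies each of the
   predicates used below. *)
Definition min_card (T : finType) (P : pred {set T}) : nat :=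
  \big[minn/#|T|]_(S : {set T} | P S) #|S|.

Definition dim_l (G : sgraph) : nat := min_card (@local_metric_generator G).
Definition dim_Al (G : sgraph) : nat := min_card (@local_adj_generator G).
Definition gamma (G : sgraph) : nat := min_card (@dominating G).

Definition local_adj_basis (G : sgraph) (S : {set G}) : bool :=
  local_adj_generator S && (#|S| == dim_Al G).

Section Corona.
Variables G H : sgraph.

(* [inl v] is the vertex v of G, and [inr (v, h)] is the vertex h of the copy of
   H attached to v. *)
Definition corona_vertex : finType := (G + G * H)%type.

Definition corona_adj (a b : corona_vertex) : bool :=
  match a, b with
  | inl v, inl w => adj v w
  | inl v, inr (w, _) => v == w
  | inr (v, _), inl w => v == w
  | inr (v, h), inr (w, k) => (v == w) && adj h k
  end.

Lemma corona_adj_sym : symmetric corona_adj.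
Proof.
case=> [v|[v h]] [w|[w k]] //=; rewrite 1?eq_sym //; first exact: adj_sym.
by rewrite adj_sym.
Qed.

Lemma corona_adj_irr : irreflexive corona_adj.
Proof. by case=> [v|[v h]] /=; rewrite adj_irr ?andbF. Qed.

Definition corona : sgraph := SGraph corona_adj_sym corona_adj_irr.

End Corona.

(* Main.v *)
Require Import Defs.
From mathcomp Require Import all_boot ssralg ssrint.
Set Implicit Arguments.
Unset Strict Implicit.
Unset Printing Implicit Defensive.

(* Write a for dim_Al H and n for #|G|.  The trace of a local metric generator,
   or of a local adjacency generator, of G (.) H on each copy H_i of H is a local
   adjacency generator of H, because vertices outside H_i do not separate two
   vertices of H_i.  Conversely the union of copies of one local adjacency basis
   B of H is a local metric generator, so dim_l (G (.) H) = n a; hence (ii) and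
   (iii) say the same thing.

   For adjacency generators the edges v_i h with h in H_i remain: v_i h is
   separated by a vertex of B_i unless B is contained in N(h), and otherwise only
   by a neighbour of v_i in G.  If some B satisfies no inclusion B <= N(h) with h
   outside B, its copies alone form a local adjacency generator and
   dim_Al (G (.) H) <= n a.  If every basis satisfies one, then for each local
   adjacency generator S the vertices v_i such that v_i is in S or S has more
   than a vertices in H_i dominate G, whence #|S| >= n a + gamma G; a union of
   copies of B with a minimum dominating set of G attains this bound. *)

(** * Minima over finite families with a default value *)

Lemma bigminn_le_idx (I : finType) (P : pred I) (F : I -> nat) m :
  \big[minn/m]_(i | P i) F i <= m.
Proof. by elim/big_rec: _ => // i x _; rewrite geq_min orbC => ->. Qed.

Lemma bigminn_le (I : finType) (P : pred I) (F : I -> nat) m i :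
  P i -> \big[minn/m]_(i | P i) F i <= F i.
Proof.
move=> Pi; rewrite unlock; have := mem_index_enum i.
elim: (index_enum I) => //= j r IHr; rewrite inE => /predU1P[<-|/IHr le_r].
  by rewrite Pi geq_minl.
by case: (P j) => //; rewrite geq_min le_r orbT.
Qed.

Lemma bigminn_attained (I : finType) (P : pred I) (F : I -> nat) m :
  \big[minn/m]_(i | P i) F i < m ->
  exists2 i, P i & F i = \big[minn/m]_(i | P i) F i.
Proof.
elim/big_rec: _ => [|i x Pi IHx]; first by rewrite ltnn.
by case: (leqP (F i) x) => [_ _|_]; [exists i | apply: IHx].
Qed.

Lemma min_card_le (T : finType) (P : pred {set T}) S :
  P S -> min_card P <= #|S|.
Proof. exact: bigminn_le. Qed.

(** If the minimum equals the default [#|T|], the full set attains it, hence the hypothesis on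
    [[set: T]]. *)
Lemma min_card_attained (T : finType) (P : pred {set T}) :
  P [set: T] -> exists2 S, P S & #|S| = min_card P.
Proof.
move=> PT; have := bigminn_le_idx P (fun S => #|S|) #|T|; rewrite leq_eqVlt.
case/predU1P=> [eqT | /bigminn_attained//].
by exists [set: T]; rewrite // cardsT.
Qed.

(** * Distance, generators and domination in one graph *)

Section Graph.
Variable G : sgraph.
Implicit Types (x y z s : G) (S : {set G}).

Lemma has_walkP k x y :
  reflect (exists p : seq G, [/\ size p = k, path (@adj G) x p & last x p = y])
          (has_walk k x y).
Proof.
apply: (iffP existsP) => [[p /andP[xp /eqP <-]] | [p [<- xp <-]]].
  by exists p; rewrite size_tuple.
by exists (in_tuple p); rewrite xp eqxx.
Qed.

Lemma dist_le_card x y : dist x y <= #|G|.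
Proof. exact: (bigminn_le_idx (fun k : 'I__ => has_walk k x y)). Qed.

Lemma dist_le_walk k x y : has_walk k x y -> dist x y <= k.
Proof.
move=> xy_k; have [lt_k|] := ltnP k #|G|; last first.
  exact: leq_trans (dist_le_card _ _).
exact: (@bigminn_le _ (fun k : 'I_#|G| => has_walk k x y) _ _ (Ordinal lt_k)).
Qed.

Lemma has_walk_dist x y : dist x y < #|G| -> has_walk (dist x y) x y.
Proof. by rewrite /dist => /bigminn_attained[k xy_k <-]. Qed.

Lemma dist_connect x y : connect (@adj G) x y -> dist x y < #|G|.
Proof.
case/connectP=> p xp ->; case/shortenP: xp => q xq Uq _.
apply: leq_ltn_trans (_ : size q < _).
  by apply/dist_le_walk/has_walkP; exists q.
by have := max_card (mem (x :: q)); rewrite (card_uniqP Uq).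
Qed.

Lemma distxx x : dist x x = 0.
Proof.
by apply/eqP; rewrite -leqn0; apply/dist_le_walk/has_walkP; exists [::].
Qed.

Lemma dist_adj x y z : adj y z -> dist x z <= (dist x y).+1.
Proof.
move=> yz; have [/has_walk_dist/has_walkP[p [<- xp xy]] | le_G] :=
  ltnP (dist x y) #|G|.
  apply/dist_le_walk/has_walkP; exists (rcons p z).
  by rewrite size_rcons rcons_path last_rcons xp xy.
by apply: leq_trans (dist_le_card _ _) _; apply: leqW.
Qed.

Lemma dist_le1 x y : (dist x y <= 1) = (x == y) || adj x y.
Proof.
apply/idP/orP=> [le1 | [/eqP->|xy]]; last 2 first.
- by rewrite distxx.
- by have := dist_adj x xy; rewrite distxx.
have [/has_walk_dist/has_walkP[p [szp xp xy]] | le_G] :=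
  ltnP (dist x y) #|G|.
  move: szp le1 xp xy => <-; case: p => [|z [|//]] /= _.
    by move=> _ ->; left.
  by rewrite andbT => xz <-; right.
(* The default value can be at most 1 only if [G] has a single vertex. *)
left; have /fintype_le1P/(_ x y) -> : #|G| <= 1 by apply: leq_trans le1.
by rewrite eqxx.
Qed.

Lemma dist_eq0 x y : (dist x y == 0) = (x == y).
Proof.
apply/eqP/eqP=> [d0|->]; last exact: distxx.
have /has_walk_dist/has_walkP : dist x y < #|G|.
  by rewrite d0; apply/card_gt0P; exists x.
by rewrite d0 => -[p [/size0nil-> _ /= ->]].
Qed.

Lemma local_metricP S :
  reflect (forall x y, adj x y -> exists2 s, s \in S & dist s x != dist s y)
          (local_metric_generator S).
Proof.
apply: (iffP 'forall_'forall_implyP) => gS x y xy.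
  by have /exists_inP[s] := gS x y xy; exists s.
by apply/exists_inP; apply: gS.
Qed.

Lemma card_nbh_pair s x y :
  x != y -> (#|nbh s :&: [set x; y]| == 1) = (adj s x != adj s y).
Proof.
move=> neq_xy; rewrite setIUr cardsU.
rewrite (_ : _ :&: [set x] :&: _ = set0) ?cards0 ?subn0; last first.
  apply/setP=> z; rewrite !inE; case: eqVneq => [->|]; rewrite ?andbF //.
  by rewrite (negPf neq_xy) !andbF.
have card1 z : #|nbh s :&: [set z]| = adj s z.
  case sz: (adj s z); first by rewrite (setIidPr _) ?cards1 // sub1set inE.
  by apply: eq_card0 => t; rewrite !inE; case: eqP => [->|]; rewrite ?sz ?andbF.
by rewrite !card1; case: (adj s x); case: (adj s y).
Qed.

Lemma local_adjP S :
  reflect (forall x y, adj x y -> x \notin S -> y \notin S ->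
             exists2 s, s \in S & adj s x != adj s y)
          (local_adj_generator S).
Proof.
have neq x y : adj x y -> x != y by case: eqVneq => // ->; rewrite adj_irr.
apply: (iffP 'forall_'forall_implyP) =>
  [gS x y xy xS yS | gS x y /and3P[xy xS yS]].
  have /exists_inP[s sS] := gS x y (introT and3P (And3 xy xS yS)).
  by rewrite card_nbh_pair ?neq //; exists s.
have [s sS sxy] := gS x y xy xS yS.
by apply/exists_inP; exists s; rewrite ?card_nbh_pair ?neq.
Qed.

Lemma local_adj_generatorT : local_adj_generator [set: G].
Proof. by apply/local_adjP=> x y _; rewrite inE. Qed.

Lemma local_metric_generatorT : local_metric_generator [set: G].
Proof.
apply/local_metricP=> x y xy; exists x; first by rewrite inE.
by rewrite distxx eq_sym dist_eq0; apply: contraL xy => /eqP->; rewrite adj_irr.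
Qed.

Lemma dominatingT : dominating [set: G].
Proof. by apply/forallP=> x; rewrite inE. Qed.

Lemma local_adj_basis_ex : exists S, local_adj_basis S.
Proof.
have [S gS cS] := min_card_attained local_adj_generatorT.
by exists S; rewrite /local_adj_basis gS cS eqxx.
Qed.

Lemma gamma_gt0 : 0 < #|G| -> 0 < gamma G.
Proof.
case/card_gt0P=> x _; have [D domD] := min_card_attained dominatingT.
rewrite -/(gamma G) => <-.
apply/card_gt0P; have /orP[xD | /exists_inP[s sD _]] := forallP domD x.
  by exists x.
by exists s.
Qed.

(** Nothing in the empty set separates the ends of an edge. Applied to [H], this yields a vertex to
    use in every copy. *)
Lemma local_adj_generator_neq0 S :
  (exists x y : G, adj x y) -> local_adj_generator S -> exists s, s \in S.
Proof.
move=> [x [y xy]] /local_adjP gS.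
have [S0|[s]] := set_0Vmem S; last by exists s.
by have [||s] := gS x y xy; rewrite ?S0 ?inE //; exists s.
Qed.

End Graph.

(** * Vertex sets of the corona and their traces *)

Section Corona.
Variables G H : sgraph.
Local Notation C := (corona G H).
Implicit Types (S : {set C}) (D : {set G}) (B : {set H}).

Definition base S : {set G} := [set v | inl v \in S].
Definition fibre S i : {set H} := [set h | inr (i, h) \in S].
Definition corona_set D B : {set C} :=
  [set c : C | match c with inl v => v \in D | inr (_, h) => h \in B end].

Lemma card_corona_split S : #|S| = #|base S| + \sum_i #|fibre S i|.
Proof.
rewrite -sum1_card big_mkcond big_sumType /=; congr (_ + _).
  by rewrite -sum1_card [RHS]big_mkcond; apply: eq_bigr => v _; rewrite inE.
transitivity (\sum_i \sum_h (if inr (i, h) \in S then 1 else 0)).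
  by rewrite pair_bigA; apply: eq_bigr => -[].
apply: eq_bigr => i _; rewrite -sum1_card [RHS]big_mkcond.
by apply: eq_bigr => h _; rewrite inE.
Qed.

Lemma card_corona_set D B : #|corona_set D B| = #|D| + #|G| * #|B|.
Proof.
rewrite card_corona_split; congr (_ + _).
  by apply: eq_card => v; rewrite !inE.
rewrite -sum_nat_const; apply: eq_bigr => i _.
by apply: eq_card => h; rewrite !inE.
Qed.

(** * Distances in the corona *)

Lemma corona_connect (i : G) (c : C) :
  connected_graph G -> connect (@adj C) c (inl i).
Proof.
move=> connG.
have connl (v : G) : connect (@adj C) (inl v) (inl i).
  have /connectP[p] := connG v i.
  elim: p v => [v _ ->|w p IHp v /= /andP[vw wp] lasti].
    exact: connect0.
  by apply: connect_trans (IHp w wp lasti); apply: connect1.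
case: c => [v|[v h]] //; apply: connect_trans (connl v).
by apply: connect1; rewrite /= eqxx.
Qed.

Definition in_copy (i : G) (c : C) : bool :=
  if c is inr (j, _) then j == i else false.

(** Copy [i] meets the rest of the corona only at [inl i], so a walk entering it from outside has a
    proper prefix ending there. *)
Lemma walk_to_copy (i : G) (h : H) k (s : C) :
  ~~ in_copy i s -> has_walk k s (inr (i, h)) ->
  exists2 j, j < k & has_walk j s (inl i).
Proof.
move=> + /has_walkP[p [<-]].
elim: p s => [|a p IHp] s out_s /=.
  by move=> _ s_h; rewrite s_h /= eqxx in out_s.
case/andP=> sa ap last_h; have [-> | s_i] := eqVneq s (inl i).
  by exists 0 => //; apply/has_walkP; exists [::].
have [|j lt_j /has_walkP[q [szq aq lastq]]] := IHp a _ ap last_h.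
  (* As [s] is not [inl i], its successor [a] is still outside copy [i]. *)
  case: a s out_s sa s_i {ap last_h} => [v|[v x]] [w|[w y]] //=.
    by move=> _ /eqP<-; apply: contra => /eqP->.
  by move=> out_s /andP[/eqP<-].
by exists j.+1 => //; apply/has_walkP; exists (a :: q) => /=; rewrite szq sa.
Qed.

Lemma dist_to_copy (i : G) (h : H) (s : C) :
  connected_graph G -> ~~ in_copy i s ->
  dist s (inr (i, h)) = (dist s (inl i)).+1.
Proof.
move=> connG out_s; apply/eqP; rewrite eqn_leq dist_adj /= ?eqxx //.
have lt_i := dist_connect (corona_connect i s connG).
have [/has_walk_dist/(walk_to_copy out_s)[j lt_j /dist_le_walk le_j]|] :=
  ltnP (dist s (inr (i, h))) #|C|; first exact: leq_ltn_trans lt_j.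
exact: leq_trans.
Qed.

(** The common neighbour [inl i] bounds the distance by 2, so distances inside a copy record exactly
    equality and adjacency in [H]. *)
Lemma dist_in_copy (i : G) (h k : H) :
  dist (inr (i, h) : C) (inr (i, k)) =
    if h == k then 0 else if adj h k then 1 else 2.
Proof.
have eq_hk : ((inr (i, h) : C) == inr (i, k)) = (h == k).
  by apply/eqP/eqP=> [[]|->].
have le2 : dist (inr (i, h) : C) (inr (i, k)) <= 2.
  have := @dist_adj C (inr (i, h)) (inl i) (inr (i, k)).
  rewrite /= eqxx => /(_ isT) /leq_trans; apply.
  have := @dist_adj C (inr (i, h)) (inr (i, h)) (inl i).
  by rewrite /= eqxx distxx => /(_ isT).
have := dist_le1 (inr (i, h) : C) (inr (i, k)).
have := dist_eq0 (inr (i, h) : C) (inr (i, k)).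
rewrite eq_hk /= eqxx /=; move: le2; case: (dist _ _) => [|[|[|]]] //= _.
- by move=> <-.
- by move=> <- /= <-.
by move=> <- /= <-.
Qed.

(** * Generators of the corona against generators of [H] *)

Lemma fibre_local_adj S i :
  local_adj_generator S -> local_adj_generator (fibre S i).
Proof.
move/local_adjP=> gS; apply/local_adjP=> x y xy; rewrite !inE => xS yS.
have [|[v|[j s]] sS /=] := gS (inr (i, x)) (inr (i, y)) _ xS yS.
- by rewrite /= eqxx.
- by rewrite eqxx.
by case: (eqVneq j i) sS => //= -> sS; exists s; rewrite ?inE.
Qed.

(** A vertex outside copy [i] is equidistant from all of it; one inside, other than [x] and [y], has
    distance 1 or 2 to each, according to adjacency. *)
Lemma fibre_local_metric S i : connected_graph G ->
  local_metric_generator S -> local_adj_generator (fibre S i).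
Proof.
move=> connG /local_metricP gS; apply/local_adjP=> x y xy.
rewrite !inE => xS yS.
have [|s sS] := gS (inr (i, x)) (inr (i, y)); first by rewrite /= eqxx.
have [|out_s] := boolP (in_copy i s); last by rewrite !dist_to_copy ?eqxx.
case: s sS => [//|[j s]] sS /= /eqP eq_ji; move: sS; rewrite {j}eq_ji => sS.
have neq z : inr (i, z) \notin S -> s != z by apply: contra => /eqP<-.
rewrite !dist_in_copy (negPf (neq x xS)) (negPf (neq y yS)) => sxy.
by exists s; [rewrite inE | move: sxy; do 2!case: (adj s _)].
Qed.

(** The last hypothesis treats the edges from [inl i] to its copy: a neighbour of [i] in [D]
    separates them, or an element of [B] not adjacent to [h]. It serves both for [D] dominating and
    for [D] empty. *)
Lemma local_adj_corona_set D B : (exists b, b \in B) ->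
  local_adj_generator B ->
  (forall i h, i \notin D -> h \notin B ->
     (exists2 j, j \in D & adj j i) \/ ~~ (B \subset nbh h)) ->
  local_adj_generator (corona_set D B).
Proof.
move=> [b bB] /local_adjP gB sepDB.
have sep_lr i h : i \notin D -> h \notin B -> exists2 s, s \in corona_set D B &
    @adj C s (inl i) != @adj C s (inr (i, h)).
  move=> iD hB; have [[j jD ji] | /subsetPn[c cB]] := sepDB i h iD hB.
    exists (inl j); rewrite ?inE //= ji; case: (eqVneq j i) ji => // ->.
    by rewrite adj_irr.
  rewrite inE adj_sym => hc; exists (inr (i, c)); first by rewrite inE.
  by rewrite /= eqxx (negPf hc).
apply/local_adjP=> -[v|[v x]] [w|[w y]]; rewrite !inE /=.
- move=> vw _ _; exists (inr (v, b)); rewrite ?inE //= eqxx.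
  by case: (eqVneq v w) vw => // ->; rewrite adj_irr.
- by move=> /eqP<-; apply: sep_lr.
- move=> /eqP<- xB vD; have [s sDB ss] := sep_lr v x vD xB.
  by exists s; rewrite // eq_sym.
move=> /andP[/eqP<- xy] xB yB; have [s sB ss] := gB x y xy xB yB.
by exists (inr (v, s)); rewrite ?inE //= eqxx.
Qed.

Lemma local_metric_corona_set B : connected_graph G -> 1 < #|G| ->
  (exists b, b \in B) -> local_adj_generator B ->
  local_metric_generator (corona_set set0 B).
Proof.
move=> connG G_gt1 [b bB] /local_adjP gB.
have memB i h : h \in B -> (inr (i, h) : C) \in corona_set set0 B.
  by rewrite inE.
have sep_lr (i : G) h : exists2 s, s \in corona_set set0 B &
    dist s (inl i) != dist s (inr (i, h)).
  (* A vertex in a different copy reaches [inr (i, h)] only through [inl i], hence one step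
     later. *)
  have [j ji] : exists j, j != i.
    have /card_gt0P[j]: 0 < #|predC1 i|.
      by rewrite cardC1; case: #|G| G_gt1 => [|[]].
    by exists j.
  exists (inr (j, b)); first exact: memB.
  by rewrite dist_to_copy // neq_ltn ltnSn.
apply/local_metricP=> -[v|[v x]] [w|[w y]] /=.
- move=> vw; exists (inr (v, b)); first exact: memB.
  have neq_vw: v != w by apply: contraL vw => /eqP->; rewrite adj_irr.
  have: dist (inr (v, b) : C) (inl v) <= 1 by rewrite dist_le1 /= eqxx.
  by apply: contraTneq => ->; rewrite dist_le1 /= (negPf neq_vw).
- by move=> /eqP<-; apply: sep_lr.
- move=> /eqP<-; have [s sB ss] := sep_lr v x.
  by exists s; rewrite // eq_sym.
move=> /andP[/eqP<- xy].
have neq_xy: x != y by apply: contraL xy => /eqP->; rewrite adj_irr.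
(* Local adjacency generation covers only edges avoiding [B]; an end in [B] separates the edge
   itself, with distances 0 and 1. *)
have [xB | xB] := boolP (x \in B).
  exists (inr (v, x)); first exact: memB.
  by rewrite !dist_in_copy eqxx (negPf neq_xy) xy.
have [yB | yB] := boolP (y \in B).
  exists (inr (v, y)); first exact: memB.
  by rewrite !dist_in_copy eqxx (eq_sym y) (negPf neq_xy) adj_sym xy.
have [s sB ss] := gB x y xy xB yB; exists (inr (v, s)); first exact: memB.
have neq z : z \notin B -> s != z by apply: contraNneq => <-.
rewrite !dist_in_copy (negPf (neq x xB)) (negPf (neq y yB)).
by move: ss; do 2!case: (adj s _).
Qed.

(** * The dimensions of the corona *)

Lemma dim_l_corona : connected_graph G -> 1 < #|G| ->
  (exists x y : H, adj x y) -> dim_l C = #|G| * dim_Al H.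
Proof.
move=> connG G_gt1 edgeH; apply/eqP; rewrite eqn_leq; apply/andP; split.
  have [B /andP[gB /eqP<-]] := local_adj_basis_ex H.
  have B_neq0 := local_adj_generator_neq0 edgeH gB.
  have := min_card_le (local_metric_corona_set connG G_gt1 B_neq0 gB).
  by rewrite card_corona_set cards0.
have [S gS] := min_card_attained (local_metric_generatorT C).
rewrite -/(dim_l C) => <-.
rewrite card_corona_split -sum_nat_const; apply: leq_trans (leq_addl _ _).
by apply: leq_sum => i _; apply/min_card_le/fibre_local_metric.
Qed.

Lemma dim_Al_corona_le : (exists x y : H, adj x y) ->
  dim_Al C <= #|G| * dim_Al H + gamma G.
Proof.
move=> edgeH; have [B /andP[gB /eqP<-]] := local_adj_basis_ex H.
have [D domD] := min_card_attained (dominatingT G).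
rewrite -/(gamma G) => <-; rewrite addnC -card_corona_set; apply: min_card_le.
apply: local_adj_corona_set => // [|i h iD _].
  exact: local_adj_generator_neq0 gB.
have := forallP domD i; rewrite (negPf iD) => /exists_inP[j jD ji].
by left; exists j.
Qed.

Lemma dim_Al_corona_ge :
  (forall B, local_adj_basis B -> exists2 v, v \notin B & B \subset nbh v) ->
  #|G| * dim_Al H + gamma G <= dim_Al C.
Proof.
move=> covB; have [S gS] := min_card_attained (local_adj_generatorT C).
rewrite -/(dim_Al C) => <-.
have ge_a i : dim_Al H <= #|fibre S i| by apply/min_card_le/fibre_local_adj.
(* These are the indices where [S] spends more than [dim_Al H] on [inl i] and its copy together. *)
pose D := [set i | (inl i \in S) || (dim_Al H < #|fibre S i|)].
have domD : dominating D.
  apply/forallP=> i; rewrite inE; case: (boolP (inl i \in S)) => //= iS.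
  case: ltnP => //= le_a.
  (* Off [D] the fibre is a basis of [H], hence contained in the neighbourhood of some [h]. *)
  have [|h] := covB (fibre S i).
    by rewrite /local_adj_basis fibre_local_adj //= eqn_leq le_a ge_a.
  rewrite inE => hS /subsetP covh.
  have [|[j|[j s]] sS /=] := local_adjP _ gS (inl i) (inr (i, h)) _ iS hS.
  - by rewrite /= eqxx.
  - case: (eqVneq j i) => [eq_ji | _ ji]; first by rewrite -eq_ji sS in iS.
    apply/exists_inP; exists j; first by rewrite inE sS.
    by case: (adj j i) ji.
  (* An element of fibre [i] is adjacent to both [inl i] and [h], so the separator must be a base
     vertex. *)
  case: (eqVneq j i) sS => //= -> sS.
  by have := covh s; rewrite !inE adj_sym => /(_ sS) ->.
apply: leq_trans (_ : #|G| * dim_Al H + #|D| <= _).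
  by rewrite leq_add2l; apply: min_card_le.
rewrite card_corona_split -sum_nat_const -!sum1_card.
rewrite (big_mkcond (mem D)) (big_mkcond (mem (base S))) -!big_split /=.
(* The bound holds index by index: the extra 1 for [i] in [D] is paid by [inl i] or by the larger
   fibre. *)
apply: leq_sum => i _; rewrite !inE; case: (inl i \in S) => /=.
  by rewrite addnC leq_add2l.
by rewrite add0n; case: ifP => [lt_a|_]; rewrite ?addn1 ?addn0.
Qed.

(** Each edge from a base vertex to its copy is now separated inside that copy, so [D] can be
    empty. *)
Lemma dim_Al_corona_basis B : (exists x y : H, adj x y) ->
  local_adj_basis B -> (forall v, v \notin B -> ~~ (B \subset nbh v)) ->
  dim_Al C <= #|G| * dim_Al H.
Proof.
move=> edgeH /andP[gB /eqP<-] uncovB.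
rewrite -[leqRHS]add0n -(cards0 G) -card_corona_set; apply: min_card_le.
apply: local_adj_corona_set => // [|i h _ /uncovB]; last by right.
exact: local_adj_generator_neq0 gB.
Qed.

End Corona.

(** * The equivalence, proved as a cycle of implications *)

Theorem theorem25 (G H : sgraph)
    (connG : connected_graph G) (orderG : 2 <= #|G|)
    (orderH : 2 <= #|H|) (edgeH : exists x y : H, adj x y) :
  [<-> (forall S : {set H}, local_adj_basis S ->
          exists2 v : H, v \notin S & S \subset nbh v);
       dim_Al (corona G H) = #|G| * dim_Al H + gamma G;
       ((dim_l (corona G H))%:Z
          = (dim_Al (corona G H))%:Z - (gamma G)%:Z)%R].
Proof.
tfae.
- move=> covB; apply/eqP.
  by rewrite eqn_leq dim_Al_corona_le //= dim_Al_corona_ge.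
- by move=> ->; rewrite dim_l_corona // PoszD GRing.addrK.
move/eqP; rewrite eq_sym GRing.subr_eq -PoszD dim_l_corona //.
move=> /eqP[eqAl] B basisB.
case: (pickP [pred v | (v \notin B) && (B \subset nbh v)]) =>
  [v /andP[] | uncovB].
  by exists v.
have uncov v : v \notin B -> ~~ (B \subset nbh v).
  by move=> vB; have := uncovB v; rewrite /= vB /= => ->.
(* An uncovered basis would force [gamma G <= 0], impossible for non-empty [G]. *)
have := dim_Al_corona_basis G edgeH basisB uncov; rewrite eqAl.
by rewrite -[leqRHS]addn0 leq_add2l leqNgt gamma_gt0 ?(ltnW orderG).
Qed.
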